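(* For $n\geq 0$, $F_n^{M'}(x,y,q)=F_n^C(x,y,q)$.
   Context: $S_n(231,312,321)$ is the set of permutations of $[n]$ with no subsequence order isomorphic to $231$, $312$ or $321$; each such $\pi$ is a layered matching, i.e. a concatenation of decreasing blocks of size $1$ or $2$, each block smaller than all later blocks. $s(\pi)$, $d(\pi)$ are the numbers of maximal decreasing runs of $\pi$ of length $1$ and $2$; $maj(\pi)=\sum_{i:\,p_i>p_{i+1}}i$; $F_n^{M'}(x,y,q)=\sum_{\pi\in S_n(231,312,321)}x^{s(\pi)}y^{d(\pi)}q^{maj(\pi)}$. A Morse sequence of length $n$ is a sequence of dots (length $1$) and dashes (length $2$) of total length $n$; $MS_n$ is the set of these. A dash preceded by a portion of total length $a$ has weight $a+1$, dots have weight $0$, and $w(\mu)$ is the total weight of $\mu$. With $t(\mu)$ the number of dots and $h(\mu)$ the number of dashes, $F_n^C(x,y,q)=\sum_{\mu\in MS_n}x^{t(\mu)}y^{h(\mu)}q^{w(\mu)}$. *)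

(* Defs.v *)
From HB Require Import structures.
From mathcomp Require Import all_boot all_order all_fingroup all_algebra.

Set Implicit Arguments.
Unset Strict Implicit.
Unset Printing Implicit Defensive.

Import GRing.Theory.

(* The one-line notation p_1 ... p_n, with values in {1, ..., n}; as
   sequences are indexed from 0, p_i is [nth 0 (word pi) i.-1]. *)
Definition word (n : nat) (pi : 'S_n) : seq nat :=
  [seq (nat_of_ord (pi i)).+1 | i <- enum 'I_n].

Definition order_isomorphic (u v : seq nat) : bool :=
  (size u == size v) &&
  [forall i : 'I_(size u), forall j : 'I_(size u),
     (nth 0 u i < nth 0 u j) == (nth 0 v i < nth 0 v j)].

(* A subsequence is selected by a bit mask on the positions. *)
Definition contains (p w : seq nat) : bool :=
  [exists m : (size w).-tuple bool, order_isomorphic (mask m w) p].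

Definition avoiders (n : nat) (ps : seq (seq nat)) : {set 'S_n} :=
  [set pi : 'S_n | all (fun p => ~~ contains p (word pi)) ps].

Definition S_231_312_321 (n : nat) : {set 'S_n} :=
  avoiders n [:: [:: 2; 3; 1]; [:: 3; 1; 2]; [:: 3; 2; 1]].

(* Positions are 0-based here and in the run counts below. *)
Definition decreasing_factor (w : seq nat) (i k : nat) : bool :=
  (i + k <= size w) && sorted gtn (take k (drop i w)).

Definition maximal_decreasing_run (w : seq nat) (i k : nat) : bool :=
  [&& 0 < k, decreasing_factor w i k,
      ~~ ((0 < i) && decreasing_factor w i.-1 k.+1)
    & ~~ decreasing_factor w i k.+1].

Definition num_runs (k : nat) (w : seq nat) : nat :=
  #|[set i : 'I_(size w) | maximal_decreasing_run w i k]|.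

Definition s_stat (n : nat) (pi : 'S_n) : nat := num_runs 1 (word pi).
Definition d_stat (n : nat) (pi : 'S_n) : nat := num_runs 2 (word pi).

(* Here i is the 1-based position: the condition reads p_i > p_{i+1}. *)
Definition maj (n : nat) (pi : 'S_n) : nat :=
  \sum_(1 <= i < n | nth 0 (word pi) i.-1 > nth 0 (word pi) i) i.

Inductive symbol : predArgType := MorseDot | MorseDash.

Definition is_dash (a : symbol) : bool :=
  if a is MorseDash then true else false.
Definition symbol_of_bool (b : bool) : symbol :=
  if b then MorseDash else MorseDot.
Lemma is_dashK : cancel is_dash symbol_of_bool. Proof. by case. Qed.

HB.instance Definition _ := Finite.copy symbol (can_type is_dashK).

Definition symbol_length (a : symbol) : nat := if a is MorseDash then 2 else 1.

Definition total_length (mu : seq symbol) : nat :=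
  \sum_(a <- mu) symbol_length a.

(* A Morse sequence of length n has at most n symbols, so that bounding the
   number of symbols by n loses nothing and gives a finite type. *)
Definition MS (n : nat) : {set n.-bseq symbol} :=
  [set mu : n.-bseq symbol | total_length mu == n].

Definition dots (mu : seq symbol) : nat := count_mem MorseDot mu.
Definition dashes (mu : seq symbol) : nat := count_mem MorseDash mu.

(* The portion preceding the i-th symbol is [take i mu]. *)
Definition morse_weight (mu : seq symbol) : nat :=
  \sum_(0 <= i < size mu | nth MorseDot mu i == MorseDash)
    (total_length (take i mu)).+1.

Local Open Scope ring_scope.

(* x, y, q range over an arbitrary commutative ring; indeterminates are the
   special case where R is a polynomial ring in x, y, q. *)
Definition F_M' (R : comNzRingType) (n : nat) (x y q : R) : R :=
  \sum_(pi in S_231_312_321 n) x ^+ s_stat pi * y ^+ d_stat pi * q ^+ maj pi.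

Definition F_C (R : comNzRingType) (n : nat) (x y q : R) : R :=
  \sum_(mu in MS n) x ^+ dots mu * y ^+ dashes mu * q ^+ morse_weight mu.

(* Main.v *)
Require Import Defs.
From mathcomp Require Import all_boot all_algebra.
From mathcomp Require Import perm zify.

(** A permutation avoids 231, 312 and 321 exactly when every entry is smaller
    than all entries at distance at least two to its right, since these are
    the patterns of length three whose first letter exceeds the last. If such
    a word has smallest letter m, then m comes first, or else second and right
    after m+1; so the word is a concatenation of layers of size one and two,
    i.e. it is read off from a Morse sequence. The layers are the maximal
    decreasing runs, and a layer of size two preceded by a letters creates a
    single descent, at position a+1, which is the weight of the dash. *)

(** * Layered words of Morse sequences *)

Lemma total_length_cons (s : symbol) (mu : seq symbol) :
  total_length (s :: mu) = symbol_length s + total_length mu.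
Proof. by rewrite /total_length big_cons. Qed.

Lemma total_length_nil : total_length [::] = 0.
Proof. by rewrite /total_length big_nil. Qed.

Lemma size_le_total_length (mu : seq symbol) : size mu <= total_length mu.
Proof.
elim: mu => [|s mu IH] //; rewrite total_length_cons /=.
by case: s => /=; lia.
Qed.

(** [a] is the number of letters already placed, hence also the largest letter so far. *)
Fixpoint layered_word (a : nat) (mu : seq symbol) : seq nat :=
  match mu with
  | [::] => [::]
  | MorseDot :: mu' => a.+1 :: layered_word a.+1 mu'
  | MorseDash :: mu' => a.+2 :: a.+1 :: layered_word a.+2 mu'
  end.

Lemma perm_swap_head (T : eqType) (x y : T) (s t : seq T) :
  perm_eq [:: x, y & s] t = perm_eq [:: y, x & s] t.
Proof. exact: (perm_catCA [:: x] [:: y] s t). Qed.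

Lemma perm_layered_word (a : nat) (mu : seq symbol) :
  perm_eq (layered_word a mu) (iota a.+1 (total_length mu)).
Proof.
elim: mu a => [|[] mu IH] a /=; rewrite ?total_length_nil ?total_length_cons //=.
  by rewrite perm_cons.
by rewrite perm_swap_head !perm_cons.
Qed.

Lemma layered_word_gt (a z : nat) (mu : seq symbol) :
  z \in layered_word a mu -> a < z.
Proof. by rewrite (perm_mem (perm_layered_word a mu)) mem_iota => /andP[]. Qed.

(** The first letter, [a.+1] or [a.+2], reveals the first symbol. *)
Lemma layered_word_inj (a : nat) : injective (layered_word a).
Proof.
move=> mu; elim: mu a => [|[] mu IH] a [|[] nu] //= [].
- by move/IH ->.
- by move/eqP; rewrite eqn_leq ltnn andbF.
- by move/eqP; rewrite eqn_leq ltnn.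
- by move/IH ->.
Qed.

(** * Words increasing at distance two are the layered ones *)

(** The middle letter [y] is free; its presence only says that [x] and [z] are not adjacent. *)
Definition increasing_at_distance_two (w : seq nat) : Prop :=
  forall x y z, subseq [:: x; y; z] w -> x < z.

(** A layer has at most two letters, so [z] lies in a later layer than [x]. *)
Lemma layered_word_increasing (a : nat) (mu : seq symbol) :
  increasing_at_distance_two (layered_word a mu).
Proof.
elim: mu a => [|[] mu IH] a x y z.
- by [].
- rewrite /=; case: eqP => [-> sub|_ /IH //].
  by apply: layered_word_gt; apply: (mem_subseq sub); rewrite !inE eqxx orbT.
- have mem u v : subseq [:: u; v] (layered_word a.+2 mu) -> a.+2 < v.
    move=> sub; apply: layered_word_gt; apply: (mem_subseq sub).
    by rewrite !inE eqxx orbT.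
  have mem1 u : subseq [:: u] (layered_word a.+2 mu) -> a.+2 < u.
    by rewrite sub1seq => /layered_word_gt.
  rewrite [layered_word _ _]/= /subseq -/subseq.
  case: (x =P a.+2) => [->|_].
    by case: (y =P a.+1) => [_ /mem1|_ /mem].
  case: (x =P a.+1) => [-> /mem|_ /IH //]; lia.
Qed.

(** The induction is strong because removing a dash shortens the word by two letters. *)
Lemma increasing_layered (n a : nat) (w : seq nat) :
    perm_eq w (iota a.+1 n) -> increasing_at_distance_two w ->
  exists2 mu, total_length mu = n & w = layered_word a mu.
Proof.
elim/ltn_ind: n a w => n IH a w pw inc.
have mem z : (z \in w) = (a < z <= a + n).
  by rewrite (perm_mem pw) mem_iota; lia.
have uw : uniq w by rewrite (perm_uniq pw) iota_uniq.
have sw : size w = n by rewrite (perm_size pw) size_iota.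
case: n => [|n] in IH pw sw mem *.
  by exists [::]; [rewrite total_length_nil | apply: size0nil].
case: w => [|v w] // in pw inc mem uw sw *.
case: (v =P a.+1) => [ev|nv].
  subst v; have [||mu tm ->] := IH n (ltnSn n) a.+1 w.
  - by move: pw; rewrite /= perm_cons.
  - by move=> x y z s; apply: (inc x y z); apply: subseq_trans s (subseq_cons _ _).
  by exists (MorseDot :: mu); rewrite ?total_length_cons ?tm.
have : a.+1 \in v :: w by rewrite mem; lia.
rewrite inE; case: eqP => [/esym//|_] /=.
have av : a < v by have := mem v; rewrite inE eqxx /=; lia.
case: w => [|u w] // in pw inc mem uw sw *.
rewrite inE; case: (a.+1 =P u) => [eu _|_ /= aw]; last first.
  (* If [a.+1] came third or later, [v], [u], [a.+1] would force [v < a.+1]. *)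
  have: v < a.+1 by apply: (inc v u); rewrite /= !eqxx sub1seq.
  lia.
subst u.
case: n => [|n] // in IH pw sw mem *.
case: (v =P a.+2) => [ev|nv2]; last first.
  have : a.+2 \in [:: v, a.+1 & w] by rewrite mem; lia.
  rewrite !inE; case: eqP => [/esym//|_] /=; case: eqP => [|_ /= aw]; first lia.
  (* Here [a.+2] comes after [v] and [a.+1], which forces [v = a.+1], already excluded. *)
  have: v < a.+2 by apply: (inc v a.+1); rewrite /= !eqxx sub1seq.
  lia.
subst v; have [||mu tm ->] := IH n (leqnSn n.+1) a.+2 w.
- by move: pw; rewrite perm_swap_head !perm_cons.
- move=> x y z s; apply: (inc x y z); apply: subseq_trans s _.
  exact: subseq_trans (subseq_cons _ _) (subseq_cons _ _).
by exists (MorseDash :: mu); rewrite ?total_length_cons ?tm.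
Qed.

(** * Pattern avoidance as increase at distance two *)

Lemma containsP (p w : seq nat) :
  reflect (exists2 s, subseq s w & order_isomorphic s p) (contains p w).
Proof.
apply: (iffP existsP) => [[m iso]|[s /subseqP[m sm ->] iso]].
  by exists (mask m w) => //; apply: mask_subseq.
by exists (Tuple (introT eqP sm)).
Qed.

Lemma order_isomorphic3 (x y z p1 p2 p3 : nat) :
  order_isomorphic [:: x; y; z] [:: p1; p2; p3] =
  [&& (x < y) == (p1 < p2), (x < z) == (p1 < p3), (y < x) == (p2 < p1),
      (y < z) == (p2 < p3), (z < x) == (p3 < p1) & (z < y) == (p3 < p2)].
Proof.
apply/idP/idP.
  move=> /andP[_ /forallP H].
  have h (i j : 'I_3) := forallP (H i) j.
  have h01 := h (@Ordinal 3 0 isT) (@Ordinal 3 1 isT).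
  have h02 := h (@Ordinal 3 0 isT) (@Ordinal 3 2 isT).
  have h10 := h (@Ordinal 3 1 isT) (@Ordinal 3 0 isT).
  have h12 := h (@Ordinal 3 1 isT) (@Ordinal 3 2 isT).
  have h20 := h (@Ordinal 3 2 isT) (@Ordinal 3 0 isT).
  have h21 := h (@Ordinal 3 2 isT) (@Ordinal 3 1 isT).
  by apply/and5P; split=> //; apply/andP.
move=> /and5P[h01 h02 h10 h12 /andP[h20 h21]].
apply/andP; split=> //.
by apply/forallP => -[[|[|[|i]]] // ?]; apply/forallP => -[[|[|[|j]]] // ?];
  rewrite /= ?ltnn.
Qed.

Lemma avoid_231_312_321P (w : seq nat) : uniq w ->
  all (fun p => ~~ contains p w) [:: [:: 2; 3; 1]; [:: 3; 1; 2]; [:: 3; 2; 1]]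
    <-> increasing_at_distance_two w.
Proof.
move=> uw; split=> [/and4P[/containsP n231 /containsP n312 /containsP n321 _]|inc].
  move=> x y z s; have := subseq_uniq s uw.
  rewrite /= !inE negb_or andbT => /andP[/andP[nxy nxz] nyz].
  rewrite ltnNge leq_eqVlt eq_sym (negbTE nxz) /=; apply/negP => lt_zx.
  (* Given [z < x], the place of [y] among them decides which of the three patterns occurs. *)
  case: (ltnP x y) => [lt_xy|le_yx].
    by apply: n231; exists [:: x; y; z] => //; rewrite order_isomorphic3; lia.
  case: (ltnP y z) => [lt_yz|le_zy].
    by apply: n312; exists [:: x; y; z] => //; rewrite order_isomorphic3; lia.
  by apply: n321; exists [:: x; y; z] => //; rewrite order_isomorphic3; lia.
have no p1 p2 p3 : p3 < p1 -> ~~ contains [:: p1; p2; p3] w.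
  move=> lt_p; apply/containsP => -[s sub iso].
  have /andP[/eqP/= sz _] := iso.
  case: s => [|x [|y [|z []]]] // in sub iso sz.
  by move: iso (inc _ _ _ sub); rewrite order_isomorphic3; lia.
by rewrite /= !no.
Qed.

(** * Permutations and their one-line notation *)

Lemma size_word (n : nat) (pi : 'S_n) : size (word pi) = n.
Proof. by rewrite size_map -cardE card_ord. Qed.

Lemma nth_word (n : nat) (pi : 'S_n) (i : 'I_n) : nth 0 (word pi) i = (pi i).+1.
Proof.
by rewrite /word (nth_map i) ?nth_ord_enum // -cardE card_ord.
Qed.

Lemma word_inj (n : nat) : injective (@word n).
Proof.
move=> pi rho e; apply/permP => i; apply: val_inj; apply: succn_inj.
by rewrite -!nth_word e.
Qed.

Lemma uniq_word (n : nat) (pi : 'S_n) : uniq (word pi).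
Proof.
rewrite map_inj_uniq ?enum_uniq // => i j [] e.
by apply: (@perm_inj _ pi); apply: val_inj.
Qed.

Lemma perm_word (n : nat) (pi : 'S_n) : perm_eq (word pi) (iota 1 n).
Proof.
have sub : {subset word pi <= iota 1 n}.
  by move=> z /mapP[i _ ->]; rewrite mem_iota /=; have := ltn_ord (pi i); lia.
have [|_ eq_mem] := uniq_min_size (uniq_word _ pi) sub.
  by rewrite size_word size_iota.
exact: uniq_perm (uniq_word _ pi) (iota_uniq _ _) eq_mem.
Qed.

Lemma word_surj (n : nat) (w : seq nat) :
  perm_eq w (iota 1 n) -> exists pi : 'S_n, word pi = w.
Proof.
move=> pw; have sw : size w = n by rewrite (perm_size pw) size_iota.
have wi (i : 'I_n) : 0 < nth 0 w i <= n.
  have : nth 0 w i \in w by rewrite mem_nth ?sw.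
  by rewrite (perm_mem pw) mem_iota; lia.
(* Letters start at 1 and ordinals at 0, hence the predecessor; it is injective on positive
   letters. *)
have lt (i : 'I_n) : (nth 0 w i).-1 < n by have := wi i; lia.
have inj : injective (fun i => Ordinal (lt i)).
  move=> i j [] e; apply: val_inj; apply/eqP.
  rewrite -(@nth_uniq _ 0 w) ?sw ?(perm_uniq pw) ?iota_uniq ?ltn_ord //.
  have /andP[wi0 _] := wi i; have /andP[wj0 _] := wi j.
  by apply/eqP; rewrite -(prednK wi0) -(prednK wj0) e.
exists (perm inj); apply: (@eq_from_nth _ 0); rewrite size_word ?sw // => i lt_i.
rewrite (nth_word _ _ (Ordinal lt_i)) permE /= prednK //.
by have /andP[] := wi (Ordinal lt_i).
Qed.

(** * Maximal decreasing runs of layered words *)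

Lemma num_runsE (k : nat) (w : seq nat) :
  num_runs k w = count (fun i => maximal_decreasing_run w i k) (iota 0 (size w)).
Proof.
by rewrite /num_runs cardsE cardE size_filter -enumT -val_enum_ord count_map.
Qed.

(** There is no descent after [v], so [v] is a run by itself and no run of [w] extends to the
    left. *)
Lemma num_runs_cons1 (k v : nat) (w : seq nat) : all (ltn v) w ->
  num_runs k.+1 (v :: w) = (k == 0) + num_runs k.+1 w.
Proof.
move=> lt_v; rewrite !num_runsE /= (iotaDl 1) count_map.
have long j : decreasing_factor (v :: w) 0 j.+2 = false.
  case: w lt_v => [|u w] //= /andP[lt_vu _].
  by rewrite /decreasing_factor /= ltnNge (ltnW lt_vu) andbF.
congr (_ + _).
  rewrite /maximal_decreasing_run long /= andbT.
  by case: k => [|k]; rewrite ?long // /decreasing_factor /= take0.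
by apply: eq_count => -[|i] //=; rewrite /maximal_decreasing_run /= long.
Qed.

(** The letters [u], [v] form one run: no run starts at [v], which extends left to [u], and none
    crosses from [v] into [w]. *)
Lemma num_runs_cons2 (k u v : nat) (w : seq nat) : v < u -> all (ltn u) w ->
  num_runs k.+1 [:: u, v & w] = (k == 1) + num_runs k.+1 w.
Proof.
move=> lt_vu lt_u; rewrite !num_runsE /= (iotaDl 2) count_map.
have lt_v : all (ltn v) w.
  by apply: sub_all lt_u => z /=; apply: ltn_trans.
have long j : decreasing_factor (v :: w) 0 j.+2 = false.
  case: w lt_v {lt_u} => [|z w] //= /andP[lt_vz _].
  by rewrite /decreasing_factor /= ltnNge (ltnW lt_vz) andbF.
have long2 j : decreasing_factor [:: u, v & w] 0 j.+3 = false.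
  case: w lt_v {lt_u long} => [|z w] //= /andP[lt_vz _].
  by rewrite /decreasing_factor /= [z < v]ltnNge (ltnW lt_vz) !andbF.
have short j : j < 3 -> decreasing_factor [:: u, v & w] 0 j.
  by case: j => [|[|[|]]] // _; rewrite /decreasing_factor /= ?take0 /= ?lt_vu.
have short1 : decreasing_factor [:: u, v & w] 1 1.
  by rewrite /decreasing_factor /= take0.
have long1 j : decreasing_factor [:: u, v & w] 1 j.+2 = false by exact: long.
rewrite addnA; congr (_ + _).
  rewrite /maximal_decreasing_run /=.
  by case: k => [|[|k]]; rewrite ?long1 ?long2 ?short //= ?short1.
by apply: eq_count => -[|i] //=; rewrite /maximal_decreasing_run /= long1.
Qed.

Lemma num_runs1_layered_word (a : nat) (mu : seq symbol) :
  num_runs 1 (layered_word a mu) = dots mu.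
Proof.
elim: mu a => [|[] mu IH] a; first by rewrite num_runsE.
  rewrite num_runs_cons1 ?IH //; apply/allP => z; exact: layered_word_gt.
rewrite num_runs_cons2 ?IH //; apply/allP => z; exact: layered_word_gt.
Qed.

Lemma num_runs2_layered_word (a : nat) (mu : seq symbol) :
  num_runs 2 (layered_word a mu) = dashes mu.
Proof.
elim: mu a => [|[] mu IH] a; first by rewrite num_runsE.
  rewrite num_runs_cons1 ?IH //; apply/allP => z; exact: layered_word_gt.
rewrite num_runs_cons2 ?IH //; apply/allP => z; exact: layered_word_gt.
Qed.

(** * Major index and Morse weight *)

(** The major index of [w] when [o] letters precede it: a descent right after the head is at
    position [o.+1]. *)
Fixpoint maj_from (o : nat) (w : seq nat) : nat :=
  if w is u :: w' then
    (if w' is v :: _ then (v < u) * o.+1 else 0) + maj_from o.+1 w'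
  else 0.

Lemma maj_fromE (o : nat) (w : seq nat) :
  maj_from o w =
  \sum_(1 <= i < size w | nth 0 w i < nth 0 w i.-1) (o + i).
Proof.
elim: w o => [|u w IH] o /=; first by rewrite big_geq.
rewrite {}IH; case: w => [|v w]; first by rewrite !big_geq.
rewrite /= [RHS]big_ltn_cond //= addn1 [in RHS]big_add1 /= [in RHS]big_nat_cond.
rewrite [in LHS]big_nat_cond.
(* [big_ltn_cond] leaves a test on the first summand; it becomes the boolean factor of
   [maj_from]. *)
have -> c d e : (if c then d + e else e) = (c : bool) * d + e by case: c; lia.
congr (_ + _); apply: eq_big => [[|i]|i _] //; lia.
Qed.

Lemma maj_word (n : nat) (pi : 'S_n) : maj pi = maj_from 0 (word pi).
Proof. by rewrite maj_fromE size_word. Qed.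

Fixpoint weight_from (o : nat) (mu : seq symbol) : nat :=
  match mu with
  | [::] => 0
  | MorseDot :: mu' => weight_from o.+1 mu'
  | MorseDash :: mu' => o.+1 + weight_from o.+2 mu'
  end.

Lemma weight_fromE (o : nat) (mu : seq symbol) :
  weight_from o mu =
  \sum_(0 <= i < size mu | nth MorseDot mu i == MorseDash)
    (o + total_length (take i mu)).+1.
Proof.
elim: mu o => [|s mu IH] o /=; first by rewrite big_geq.
rewrite [RHS]big_ltn_cond //= big_add1 /= total_length_nil addn0.
case: s; rewrite /= IH; [|congr (_ + _)]; apply: eq_bigr => i _;
  rewrite total_length_cons /=; lia.
Qed.

Lemma morse_weightE (mu : seq symbol) : morse_weight mu = weight_from 0 mu.
Proof. by rewrite weight_fromE. Qed.

Lemma maj_from_cons_lt (o u : nat) (w : seq nat) : all (ltn u) w ->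
  maj_from o (u :: w) = maj_from o.+1 w.
Proof. by case: w => [|v w] //= /andP[lt_uv _]; rewrite ltnNge (ltnW lt_uv). Qed.

(** The same [a] counts preceding letters and preceding length, so a dash adds [a.+1] on both sides;
    there is no descent between layers. *)
Lemma maj_from_layered_word (a : nat) (mu : seq symbol) :
  maj_from a (layered_word a mu) = weight_from a mu.
Proof.
elim: mu a => [|[] mu IH] a //.
  rewrite [layered_word _ _]/= maj_from_cons_lt ?IH //.
  by apply/allP => z; apply: layered_word_gt.
have -> : maj_from a (layered_word a (MorseDash :: mu)) =
    (a.+1 < a.+2) * a.+1 + maj_from a.+1 (a.+1 :: layered_word a.+2 mu) by [].
rewrite ltnSn mul1n maj_from_cons_lt ?IH //.
by apply/allP => z /layered_word_gt /ltnW.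
Qed.

(** * Layered permutations and reindexing of the sum *)

(* The identity is a junk value, taken when [mu] does not have length [n]. *)
Definition layered_perm (n : nat) (mu : seq symbol) : 'S_n :=
  odflt 1%g [pick pi : 'S_n | word pi == layered_word 0 mu].

Lemma word_layered_perm (n : nat) (mu : seq symbol) :
  total_length mu = n -> word (layered_perm n mu) = layered_word 0 mu.
Proof.
move=> tm; rewrite /layered_perm; case: pickP => [pi /eqP//|no].
have [|pi e] := @word_surj n (layered_word 0 mu).
  by rewrite -tm perm_layered_word.
by have := no pi; rewrite e eqxx.
Qed.

(** Stated as an image so that [big_imset] can turn the sum over permutations into one over Morse
    sequences. *)
Lemma avoiders_layered (n : nat) :
  S_231_312_321 n = [set layered_perm n mu | mu : n.-bseq symbol in MS n].
Proof.
apply/setP => pi; rewrite inE; apply/idP/imsetP => [|[mu]].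
  move/(avoid_231_312_321P _ (uniq_word _ pi)) => /increasing_layered inc.
  have [mu tm wm] := inc _ _ (perm_word _ pi).
  have sm : size mu <= n by rewrite -tm size_le_total_length.
  exists (Bseq sm); first by rewrite inE /= tm.
  by apply: word_inj; rewrite word_layered_perm.
rewrite inE => /eqP tm ->.
apply/(avoid_231_312_321P _ (uniq_word _ _)); rewrite word_layered_perm //.
exact: layered_word_increasing.
Qed.

Theorem theorem3p3 (R : comNzRingType) (n : nat) (x y q : R) :
  F_M' n x y q = F_C n x y q.
Proof.
rewrite /F_M' /F_C avoiders_layered big_imset /=.
  apply: eq_bigr => mu; rewrite inE => /eqP tm.
  rewrite /s_stat /d_stat maj_word word_layered_perm // morse_weightE.
  rewrite num_runs1_layered_word num_runs2_layered_word.
  by rewrite maj_from_layered_word.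
(* Reindexing requires injectivity on [MS n]: the permutation determines its word, and the word its
   Morse sequence. *)
move=> mu nu; rewrite !inE => /eqP tm /eqP tn e.
apply/val_inj/(@layered_word_inj 0).
by rewrite -(word_layered_perm _ _ tm) -(word_layered_perm _ _ tn) e.
Qed.
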